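(* Let $S$ be a finite set with $|S|=n\ge 2$ and let $P\in\mathcal P_S$. Then: (a) for $\mu\in\mathcal L(P)$, $k(\mu)=n$ if and only if $\operatorname{supp}(\mu)$ contains only permutations of $S$; (b) $n\in K(P)$ if and only if $P$ is doubly stochastic.
   Context: $\mathcal F_S$ is the set of all functions from $S$ to $S$; $\mathcal P_S$ is the set of all irreducible stochastic matrices $P=(p_{i,j}:i,j\in S)$ on $S$; $\mathbb N=\{1,2,\dots\}$. For $P\in\mathcal P_S$, $\mathcal L(P)$ is the set of probability measures $\mu$ on $\mathcal F_S$ that are consistent with $P$, i.e. $p_{i,j}=\mu(\{f\in\mathcal F_S:f(i)=j\})$ for all $i,j\in S$. $\operatorname{supp}(\mu)$ is the support of $\mu$. Coalescence number: let $F=(F_s:s\in\mathbb N)$ be independent random functions each with law $\mu$, let $\boldsymbol\mu=\prod_{i\in\mathbb N}\mu$ be the law of $F$, and let $\vec F_t=F_t\circ F_{t-1}\circ\cdots\circ F_1$. Define the equivalence relation $\sim$ on $S$ by $i\sim j$ if and only if $\vec F_t(i)=\vec F_t(j)$ for some $t\in\mathbb N$, and let $k(F)$ be the number of equivalence classes of $\sim$. It is known that $k(F)$ is $\boldsymbol\mu$-a.s. constant; the coalescence number $k(\mu)$ is this almost surely constant value. Finally, $K(P)=\{k:\text{there exists }\mu\in\mathcal L(P)\text{ with }k(\mu)=k\}$. *)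

(* Defs.v *)
From HB Require Import structures.
From mathcomp Require Import all_boot all_order all_algebra.
From mathcomp Require Import all_classical all_reals all_analysis.

Set Implicit Arguments.
Unset Strict Implicit.
Unset Printing Implicit Defensive.

Import Order.TTheory GRing.Theory Num.Theory.

Local Open Scope classical_set_scope.
Local Open Scope ring_scope.

Section TransitionMatrices.
Context {R : realType} {S : finType}.
Implicit Type P : S -> S -> R.

Definition stochastic P : Prop :=
  (forall i j, 0 <= P i j) /\ (forall i, \sum_j P i j = 1).

Definition doubly_stochastic P : Prop :=
  stochastic P /\ (forall j, \sum_i P i j = 1).

(* Powers are defined by hand because S is an arbitrary finType rather than
   an ordinal, so that 'M_n does not apply directly. *)
Fixpoint transition_power P (t : nat) (i j : S) : R :=
  if t is t'.+1 then \sum_l transition_power P t' i l * P l j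
  else (i == j)%:R.

Definition irreducible P : Prop :=
  forall i j, exists t : nat, 0 < transition_power P t i j.

Definition irreducible_stochastic : set (S -> S -> R) :=
  [set P | stochastic P /\ irreducible P].

End TransitionMatrices.

(* An alias of {ffun S -> S}, to which the discrete sigma-algebra is attached. *)
Definition selfmap (S : finType) : Type := {ffun S -> S}.

Section SelfmapInstances.
Variable S : finType.

HB.instance Definition _ := Finite.on (selfmap S).
HB.instance Definition _ :=
  isPointed.Build (selfmap S) ([ffun x => x] : {ffun S -> S}).
HB.instance Definition _ := @isMeasurable.Build default_measure_display
  (selfmap S) discrete_measurable discrete_measurable0
  discrete_measurableC discrete_measurableU.

End SelfmapInstances.

Definition selfmap_fun (S : finType) (f : selfmap S) : S -> S :=
  (f : {ffun S -> S}).
Coercion selfmap_fun : selfmap >-> Funclass.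

Section Consistency.
Context {R : realType} {S : finType}.

Definition consistent_laws (P : S -> S -> R) :
    set (probability (selfmap S) R) :=
  [set mu : probability (selfmap S) R |
    forall i j, (P i j)%:E = mu [set f : selfmap S | f i = j]].

(* As the sigma-algebra is discrete on a finite set, the support of mu is the
   set of its atoms. *)
Definition support_law (mu : probability (selfmap S) R) : set (selfmap S) :=
  [set f : selfmap S | (0 < mu [set f])%E].

End Consistency.

(* Sequences of self-maps are indexed from 0, so F s is the (s+1)-st map. *)
Definition cylinders (S : finType) : set (set (nat -> selfmap S)) :=
  [set C | exists s (A : set (selfmap S)), C = [set F | A (F s)]].

Arguments cylinders S : clear implicits.

Definition mapseq (S : finType) := g_sigma_algebraType (cylinders S).

Section Coalescence.
Context {R : realType} {S : finType}.

(* bmu is the law of an i.i.d. sequence of random maps with common law mu;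
   these identities determine bmu. *)
Definition product_law (mu : probability (selfmap S) R)
    (bmu : probability (mapseq S) R) : Prop :=
  forall (t : nat) (A : nat -> set (selfmap S)),
    bmu [set F | forall s, (s < t)%N -> A s (F s)] =
    (\prod_(s < t) mu (A s))%E.

Fixpoint forward (F : nat -> selfmap S) (t : nat) : S -> S :=
  if t is t'.+1 then F t' \o forward F t' else id.

Definition coalesce (F : nat -> selfmap S) (i j : S) : Prop :=
  exists t : nat, (0 < t)%N /\ forward F t i = forward F t j.

Definition coalescence_classes (F : nat -> selfmap S) : nat :=
  #|equivalence_partition (fun i j => `[< coalesce F i j >]) [set: S]%SET|.

(* k is the almost surely constant number of classes.  The product law exists
   and is unique, hence so does k. *)
Definition coalescence_number (mu : probability (selfmap S) R) (k : nat) :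
    Prop :=
  exists bmu : probability (mapseq S) R,
    product_law mu bmu /\
    {ae bmu, forall F : mapseq S, coalescence_classes F = k}.

Definition coalescence_numbers (P : S -> S -> R) : set nat :=
  [set k | exists mu, consistent_laws P mu /\ coalescence_number mu k].

End Coalescence.

(* Main.v *)
Require Import Defs.
From HB Require Import structures.
From mathcomp Require Import all_boot all_order all_algebra.
From mathcomp Require Import all_classical all_reals all_analysis.
From mathcomp Require Import zify ring lra.

Set Implicit Arguments.
Unset Strict Implicit.
Unset Printing Implicit Defensive.

Import Order.TTheory GRing.Theory Num.Theory.

(** Part (a).  The number of classes equals |S| exactly when no two distinct
states ever coalesce ([coalescence_classes_card]).  If every map charged by mu
is a permutation, then almost surely all the F_s are permutations, so are their
compositions, and nothing coalesces.  Conversely, a non-injective f with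
mu{f} > 0 merges two states at the very first step on the event F_0 = f, whose
probability mu{f} is positive, so that the number of classes is not almost
surely |S| ([coalescence_number_card]).

Since the coalescence number is defined through the law of an i.i.d. sequence,
the first implication also requires such a law to exist ([product_law_ex]).  It
is obtained as the image of the uniform law on [0, 1[ under a generalized digit
expansion: [0, 1[ is cut into one cell per map f, of length mu{f}; the cell
containing x gives the first map, and rescaling that cell to [0, 1[ gives the
number from which the next maps are read.  Each cell being an affine copy of
[0, 1[, the digits are independent with law mu ([lebesgue_sample_event]).

Part (b).  If mu charges only permutations, then the sum over i of
p_(i,j) = mu{f | f i = j} is the expected number of preimages of j, which is 1,
so P is doubly stochastic.  Conversely, by Birkhoff and von Neumann a doubly
stochastic matrix is a convex combination of permutation matrices
([birkhoff_von_neumann], which rests on the marriage theorem [hall_marriage]),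
and its weights are the masses of a law consistent with P that charges only
permutations; part (a) applies to it. *)

(** * The marriage theorem *)

(** Rado's argument.  If some N i0 has two elements x and y, one of them can be
removed without violating the condition: violating sets X for x and Y for y
would both contain i0, and counting the neighbours of the union of X and Y and
of their intersection minus i0 would contradict the condition.  Repeating this
reduces to singletons, where the condition for pairs gives injectivity. *)
Lemma hall_marriage (S T : finType) (N : S -> {set T}) :
  (forall X : {set S}, #|X| <= #|\bigcup_(i in X) N i|) ->
  exists f : S -> T, injective f /\ forall i, f i \in N i.
Proof.
have [m] := ubnP (\sum_i #|N i|); elim: m N => // m IH N ltm hallN.
case: (pickP (fun i => 1 < #|N i|)) => [i0 /card_gt1P [x [y [Nx Ny xy]]]|small].
  (* D z is the family N with z removed from N i0. *)
  pose D z i := if i == i0 then N i0 :\ z else N i.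
  have subD z i : D z i \subset N i.
    by rewrite /D; case: eqP => // ->; exact: subD1set.
  have [/existsP[z /andP[Nz /forallP hallD]]|] :=
      boolP [exists z, (z \in N i0) &&
        [forall X : {set S}, #|X| <= #|\bigcup_(i in X) D z i|]].
    have [|//|f [injf fD]] := IH (D z).
      rewrite -ltnS; apply: leq_trans ltm; rewrite ltnS.
      rewrite [ltnRHS](bigD1 i0)//= [ltnLHS](bigD1 i0)//=.
      rewrite /D eqxx [#|N i0|](cardsD1 z) Nz -addnA ltnS.
      by apply: leq_add => //; apply: leq_sum => i /negPf ->.
    by exists f; split=> // i; exact: (fintype.subsetP (subD z i)).
  rewrite negb_exists => /forallP bad; exfalso.
  move: (bad x) (bad y); rewrite Nx Ny /= !negb_forall.
  move=> /existsP[X]; rewrite -ltnNge => ltX /existsP[Y]; rewrite -ltnNge => ltY.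
  (* A set violating the condition for D z contains i0, as D z and N agree
     elsewhere. *)
  have i0_in z (Z : {set S}) : #|\bigcup_(i in Z) D z i| < #|Z| -> i0 \in Z.
    apply: contraTT => i0Z; rewrite -leqNgt; apply: leq_trans (hallN Z) _.
    apply/subset_leq_card/bigcupsP => i iZ.
    apply: (fintype.subset_trans _ (finset.bigcup_sup i iZ)).
    by rewrite /D; case: eqP i0Z => // <-; rewrite iZ.
  have i0X := i0_in _ _ ltX; have i0Y := i0_in _ _ ltY.
  set UX := \bigcup_(i in X) _ in ltX; set UY := \bigcup_(i in Y) _ in ltY.
  (* As x != y, the sets D x i0 and D y i0 together cover N i0. *)
  have leU : #|X :|: Y| <= #|UX :|: UY|.
    apply: leq_trans (hallN _) _; apply/subset_leq_card/bigcupsP => i.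
    rewrite inE => iXY; have [->|ii0] := eqVneq i i0.
      apply/fintype.subsetP => z Nz; rewrite inE; have [zx|zx] := eqVneq z x.
        apply/orP; right; apply/finset.bigcupP; exists i0 => //.
        by rewrite /D eqxx !inE Nz zx xy.
      apply/orP; left; apply/finset.bigcupP; exists i0 => //.
      by rewrite /D eqxx !inE Nz zx.
    have DN z : D z i = N i by rewrite /D (negPf ii0).
    case/orP: iXY => iZ.
      by apply/finset.subsetU/orP; left; rewrite -(DN x); exact: finset.bigcup_sup.
    by apply/finset.subsetU/orP; right; rewrite -(DN y); exact: finset.bigcup_sup.
  have leI : #|(X :&: Y) :\ i0| <= #|UX :&: UY|.
    apply: leq_trans (hallN _) _; apply/subset_leq_card/bigcupsP => i.
    rewrite !inE => /and3P[ii0 iX iY].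
    have DN z : D z i = N i by rewrite /D (negPf ii0).
    rewrite finset.subsetI; apply/andP; split.
      by rewrite -(DN x); exact: finset.bigcup_sup.
    by rewrite -(DN y); exact: finset.bigcup_sup.
  have := cardsUI X Y; have := cardsUI UX UY.
  have := cardsD1 i0 (X :&: Y); rewrite inE i0X i0Y /=.
  lia.
have N1 i : exists x, N i == [set x].
  have /cards1P[x ->] : #|N i| == 1; last by exists x.
  rewrite eqn_leq leqNgt small /=.
  by have := hallN [set i]; rewrite big_set1 cards1.
pose f i := xchoose (N1 i).
have Nf i : N i = [set f i] by exact/eqP/(xchooseP (N1 i)).
exists f; split=> [i j fij|i]; last by rewrite Nf set11.
apply/eqP; apply: contraT => ij.
have := hallN [set i; j]; rewrite cards2 ij.
have -> : \bigcup_(k in [set i; j]) N k = [set f i].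
  by rewrite finset.bigcup_setU !big_set1 !Nf fij finset.setUid.
by rewrite cards1.
Qed.

(** * Doubly stochastic matrices are mixtures of permutations *)

Local Open Scope ring_scope.

Section Birkhoff.
Variables (R : realFieldType) (S : finType).
Implicit Types (A : S -> S -> R) (c : R).

(** Allowing a common line sum other than 1 keeps the class of matrices stable
when a multiple of a permutation matrix is subtracted. *)
Definition line_sums A c : Prop :=
  [/\ forall i j, 0 <= A i j, forall i, \sum_j A i j = c
    & forall j, \sum_i A i j = c].

(** The marriage theorem applies: the rows in X carry the total mass c |X|, all
of it in the columns that these rows charge, and each column has room for c. *)
Lemma positive_diagonal A c : 0 < c -> line_sums A c ->
  exists f : S -> S, injective f /\ forall i, 0 < A i (f i).
Proof.
move=> c0 [A0 rowA colA].
have [X|f [injf fN]] := @hall_marriage S S (fun i => [set j | 0 < A i j]); last first.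
  by exists f; split=> // i; have := fN i; rewrite inE.
set NX := \bigcup_(i in X) _.
rewrite -(ler_nat R) -(ler_pM2l c0).
have -> : c * #|X|%:R = \sum_(i in X) \sum_(j in NX) A i j.
  rewrite mulr_natr -sumr_const; apply: eq_bigr => i iX.
  rewrite -(rowA i) [RHS]big_mkcond /=; apply: eq_bigr => j _.
  case: ifPn => // jN; apply/eqP; rewrite eq_le A0 andbT leNgt.
  by apply: contra jN => Aij; apply/finset.bigcupP; exists i; rewrite ?inE.
rewrite exchange_big mulr_natr -sumr_const /=; apply: ler_sum => j _.
rewrite -(colA j) big_mkcond /=; apply: ler_sum => i _.
by case: ifP.
Qed.

(** Induction on the number of positive entries: subtracting from A the
permutation matrix of a positive diagonal, scaled by its least entry, keeps A
nonnegative with equal line sums and kills an entry. *)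
Lemma birkhoff_von_neumann A c : line_sums A c ->
  exists w : {ffun S -> S} -> R, [/\ forall f, 0 <= w f,
    forall f, 0 < w f -> injective f &
    forall i j, \sum_(f : {ffun S -> S} | f i == j) w f = A i j].
Proof.
have [m] := ubnP #|[set ij : S * S | 0 < A ij.1 ij.2]|.
elim: m A c => // m IH A c ltm lA; have [A0 rowA colA] := lA.
case: (pickP (fun ij : S * S => 0 < A ij.1 ij.2)) => [[i1 j1] /= Apos|Anpos]; last first.
  exists (fun=> 0); split=> // [f|i j]; first by rewrite ltxx.
  by rewrite big1 //; apply/eqP; rewrite eq_le A0 leNgt (Anpos (i, j)).
have c0 : 0 < c.
  rewrite -(rowA i1) (bigD1 j1) //=; apply: ltr_wpDr => //.
  by apply: sumr_ge0.
have [f [injf fpos]] := positive_diagonal c0 lA.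
have [i0 _ minf] := @arg_minP _ R S i1 xpredT (fun i => A i (f i)) isT.
set e := A i0 (f i0) in minf; have e0 : 0 < e by exact: fpos.
pose B i j := A i j - (f i == j)%:R * e.
have BE i j : B i j = if f i == j then A i j - e else A i j.
  by rewrite /B; case: eqP; rewrite ?mul1r // mul0r subr0.
have B0 i j : 0 <= B i j.
  by rewrite BE; case: eqP => [<-|_]; rewrite ?A0 // subr_ge0 minf.
have lB : line_sums B (c - e).
  split=> // [i|j]; rewrite big_split /= ?rowA ?colA; congr (c + _).
    rewrite sumrN (bigD1 (f i)) //= eqxx mul1r big1 ?addr0 // => j /negPf ji.
    by rewrite eq_sym ji mul0r.
  have fg : f (invF injf j) = j by exact: f_invF.
  rewrite sumrN (bigD1 (invF injf j)) //= fg eqxx mul1r big1 ?addr0 // => i ij.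
  case: eqP => [fij|_]; last by rewrite mul0r.
  by case/eqP: ij; apply: (injf); rewrite fg.
have [|w [w0 wi wB]] := IH B (c - e) _ lB.
  rewrite -ltnS; apply: leq_trans ltm; rewrite ltnS.
  apply: proper_card; apply/fintype.properP; split.
    apply/fintype.subsetP => -[i j]; rewrite !inE /= BE.
    case: eqP => // _ /lt_le_trans; apply.
    by rewrite lerBlDr lerDl ltW.
  by exists (i0, f i0); rewrite !inE ?fpos //= BE eqxx subrr ltxx.
pose ff : {ffun S -> S} := [ffun i => f i].
exists (fun g => w g + (g == ff)%:R * e); split=> [g|g|i j].
- by rewrite addr_ge0 // mulr_ge0 // ltW.
- have [-> _|_] := eqVneq g ff; first by move=> x y; rewrite !ffunE => /injf.
  by rewrite mul0r addr0 => /wi.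
- rewrite big_split /= wB BE big_mkcond /=.
  rewrite (bigD1 ff) //= ffunE eqxx mul1r big1 ?addr0 => [|g /negPf ->]; last first.
    by rewrite mul0r if_same.
  by case: ifP; rewrite ?subrK // addr0.
Qed.

End Birkhoff.

Local Open Scope classical_set_scope.
Local Open Scope ring_scope.

(** * Coding an i.i.d. sequence by a uniform number *)

Lemma content_finType_bigcup d (T : ringOfSetsType d) (R : realFieldType)
    (mu : {content set T -> \bar R}) (I : finType) (D : set I) (F : I -> set T) :
  (forall i, D i -> measurable (F i)) -> trivIset D F ->
  mu (\bigcup_(i in D) F i) = (\sum_(i | i \in D) mu (F i))%E.
Proof.
move=> mF tF; rewrite measure_fin_bigcup //; last exact: finite_finset.
rewrite [RHS]bigfs ?index_enum_uniq ?set_mem_set // => i _.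
by rewrite mem_index_enum.
Qed.

Section Coding.
Variables (R : realType) (T : finType) (t0 : T) (w : T -> R).
Hypothesis w_ge0 : forall f, 0 <= w f.
Hypothesis w_sum1 : \sum_f w f = 1.

Definition cdf (k : nat) : R := \sum_(f | (enum_rank f < k)%N) w f.

Lemma cdf0 : cdf 0 = 0. Proof. by rewrite /cdf big_pred0. Qed.

Lemma cdf_card : cdf #|T| = 1.
Proof. by rewrite -w_sum1; apply: eq_bigl => f; rewrite ltn_ord. Qed.

Lemma cdf_rankS f : cdf (enum_rank f).+1 = cdf (enum_rank f) + w f.
Proof.
rewrite /cdf (bigD1 f) //= addrC; congr (_ + _); apply: eq_bigl => g.
rewrite ltnS ltn_neqAle andbC; congr (_ && _).
by rewrite (inj_eq val_inj) (inj_eq enum_rank_inj).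
Qed.

Lemma cdf_homo : {homo cdf : k l / (k <= l)%N >-> k <= l}.
Proof.
move=> k l kl; rewrite /cdf big_mkcond [leRHS]big_mkcond /=.
apply: ler_sum => f _; case: ifPn => [fk|_]; last by case: ifP.
by rewrite (leq_trans fk kl).
Qed.

(** The cells cut [0, 1[ into consecutive intervals of lengths w f; elements of
mass 0 have an empty cell. *)
Definition in_cell (x : R) (f : T) : bool :=
  cdf (enum_rank f) <= x < cdf (enum_rank f).+1.

Lemma in_cell_inj x f g : in_cell x f -> in_cell x g -> f = g.
Proof.
wlog fg : f g / (enum_rank f <= enum_rank g)%N => [H|].
  by case/orP: (leq_total (enum_rank f) (enum_rank g)) => fg fx gx;
    [|symmetry]; exact: H.
move=> /andP[_ xf] /andP[gx _]; apply/enum_rank_inj/val_inj/eqP.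
rewrite eqn_leq fg /= leqNgt; apply/negP => /cdf_homo /(lt_le_trans xf).
by rewrite ltNge gx.
Qed.

Lemma in_cell_ex x : 0 <= x < 1 -> exists f, in_cell x f.
Proof.
move=> /andP[x0 x1]; have /ex_minnP[k xk mink] : exists k, x < cdf k.
  by exists #|T|; rewrite cdf_card.
case: k xk mink => [|k] xk mink; first by move: xk; rewrite cdf0 ltNge x0.
have kx : cdf k <= x by rewrite leNgt; apply/negP => /mink; rewrite ltnn.
have kT : (k < #|T|)%N.
  rewrite ltnNge; apply/negP => /cdf_homo; rewrite cdf_card leNgt.
  by rewrite (le_lt_trans kx x1).
by exists (enum_val (Ordinal kT)); rewrite /in_cell enum_valK /= kx.
Qed.

(** The default t0 is taken only for x outside [0, 1[. *)
Definition digit (x : R) : T := odflt t0 [pick f | in_cell x f].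
Definition remainder (x : R) : R :=
  (x - cdf (enum_rank (digit x))) / w (digit x).
Definition sample (x : R) (s : nat) : T := digit (iter s remainder x).

Lemma digitE x f : in_cell x f -> digit x = f.
Proof.
rewrite /digit => fx; case: pickP => [g gx|/(_ f)]; last by rewrite fx.
exact: in_cell_inj gx fx.
Qed.

Lemma in_cellP x f : in_cell x f ->
  [/\ 0 < w f, 0 <= x < 1 & 0 <= (x - cdf (enum_rank f)) / w f < 1].
Proof.
move=> /andP[fx]; rewrite cdf_rankS => xf.
have wf : 0 < w f by rewrite -(ltrD2l (cdf (enum_rank f))) addr0 (le_lt_trans fx).
have c0 := @cdf_homo 0 (enum_rank f) isT; rewrite cdf0 in c0.
have c1 := cdf_homo (ltn_ord (enum_rank f)); rewrite cdf_card cdf_rankS in c1.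
split=> //; first by rewrite (le_trans c0 fx) (lt_le_trans xf c1).
rewrite divr_ge0 ?subr_ge0 ?(ltW wf) //=.
by rewrite ltr_pdivrMr // mul1r ltrBlDl.
Qed.

Lemma in_cell_rescaled x f : 0 < w f ->
  in_cell x f = (0 <= (x - cdf (enum_rank f)) / w f < 1).
Proof.
move=> wf; rewrite /in_cell cdf_rankS pmulr_lge0 ?invr_gt0 // subr_ge0.
by rewrite ltr_pdivrMr // mul1r ltrBlDl.
Qed.

Definition sample_event (t : nat) (A : nat -> set T) : set R :=
  [set x | 0 <= x < 1 /\ forall s, (s < t)%N -> A s (sample x s)].

Lemma sampleS x f s : in_cell x f ->
  sample x s.+1 = sample ((x - cdf (enum_rank f)) / w f) s.
Proof. by move=> fx; rewrite /sample iterSr {2}/remainder (digitE fx). Qed.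

Lemma sample_eventS t A x :
  sample_event t.+1 A x <->
  exists f, [/\ A 0%N f, 0 < w f &
    sample_event t (fun s => A s.+1) ((x - cdf (enum_rank f)) / w f)].
Proof.
split=> [[x01 Ax]|[f [Af wf [y01 Ay]]]].
  have [f fx] := in_cell_ex x01; have [wf _ y01] := in_cellP fx.
  exists f; split=> //; first by rewrite -(digitE fx); exact: (Ax 0%N).
  by split=> // s st; rewrite -sampleS //; exact: Ax.
rewrite -in_cell_rescaled // in y01; have [_ x01 _] := in_cellP y01.
split=> // -[_|s]; first by rewrite /sample /= (digitE y01).
by rewrite ltnS (sampleS _ y01) => /Ay.
Qed.

(** Quantifying over all affine copies a + b E of the event is what makes the
induction on t work: the copy of the event for t + 1 digits is the disjoint
union, over the possible first digits f, of copies of ratio b * w f of an event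
for t digits. *)
Lemma lebesgue_sample_event t A (a b : R) : 0 < b ->
  let E := [set y | sample_event t A ((y - a) / b)] in
  measurable (E : set (measurableTypeR R)) /\
  lebesgue_measure (E : set (measurableTypeR R)) =
    (b%:E * \prod_(s < t) \sum_(f | f \in A s) (w f)%:E)%E.
Proof.
elim: t A a b => [|t IH] A a b b0 E.
  have -> : E = `[a, a + b[%classic.
    apply/seteqP; split => y; rewrite /E /sample_event /= in_itv /=.
      by rewrite pmulr_lge0 ?invr_gt0 // subr_ge0 ltr_pdivrMr // mul1r ltrBlDl => -[].
    by rewrite pmulr_lge0 ?invr_gt0 // subr_ge0 ltr_pdivrMr // mul1r ltrBlDl.
  split; first exact: measurable_itv.
  rewrite lebesgue_measure_itv /= lte_fin ltrDl b0 -EFinB big_ord0 mule1.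
  by congr (_%:E); lra.
(* First digits of mass 0 never occur and are left out of the union, as there
   is no rescaling of their cells. *)
pose D := [set f | A 0%N f /\ 0 < w f].
pose G f := [set y | sample_event t (fun s => A s.+1)
                       ((y - (a + b * cdf (enum_rank f))) / (b * w f))].
have ED : E = \bigcup_(f in D) G f.
  have resc y f : 0 < w f -> ((y - a) / b - cdf (enum_rank f)) / w f =
      (y - (a + b * cdf (enum_rank f))) / (b * w f).
    by move=> wf; field; rewrite !gt_eqF.
  apply/seteqP; split => y.
    move=> /sample_eventS[f [Af wf Ey]]; exists f => //.
    by rewrite /G /= -resc.
  move=> [f [Af wf] Ey]; apply/sample_eventS; exists f; split=> //.
  by rewrite resc.
have IHD f : D f -> measurable (G f : set (measurableTypeR R)) /\
    lebesgue_measure (G f : set (measurableTypeR R)) =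
    ((b * w f)%:E * \prod_(s < t) \sum_(g | g \in A s.+1) (w g)%:E)%E.
  by move=> [_ wf]; apply: (IH (fun s => A s.+1)); exact: mulr_gt0.
have mG f : D f -> measurable (G f : set (measurableTypeR R)) by move=> /IHD[].
have tG : trivIset D G.
  move=> f g [_ wf] [_ wg] [y [[fy _] [gy _]]].
  have resc h : 0 < w h -> (y - (a + b * cdf (enum_rank h))) / (b * w h) =
      ((y - a) / b - cdf (enum_rank h)) / w h.
    by move=> wh; field; rewrite !gt_eqF.
  rewrite !resc -?in_cell_rescaled // in fy gy.
  exact: in_cell_inj fy gy.
rewrite ED; split.
  apply: fin_bigcup_measurable => //; exact: finite_finset.
rewrite content_finType_bigcup //.
rewrite big_ord_recl muleA ge0_sume_distrr => [|f _]; last by rewrite lee_fin.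
rewrite ge0_sume_distrl => [|f _]; last by rewrite mule_ge0 // lee_fin ?(ltW b0).
rewrite big_mkcond [RHS]big_mkcond /=; apply: eq_bigr => f _.
case: ifPn => [|fD].
  rewrite inE => Df; have [_ ->] := IHD _ Df.
  by case: Df => Af _; rewrite mem_set // EFinM.
case: ifPn => //; rewrite inE => Af.
have -> : w f = 0.
  apply/eqP; rewrite eq_le w_ge0 andbT leNgt; apply: contra fD => wf.
  by rewrite inE.
by rewrite mule0 mul0e.
Qed.

End Coding.

Lemma selfmap_law_sum (R : realType) (S : finType)
    (mu : probability (selfmap S) R) (A : set (selfmap S)) :
  mu A = (\sum_(f : selfmap S | f \in A) (fine (mu [set f]))%:E)%E.
Proof.
have {1}-> : A = \bigcup_(f in A) [set f] by rewrite bigcup_imset1 image_id.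
rewrite content_finType_bigcup //; last by move=> f g _ _ [h [-> ->]].
by apply: eq_bigr => f _; rewrite fineK // fin_num_measure.
Qed.

(** * Existence of the law of an i.i.d. sequence *)

Section UniformUnit.
Variable R : realType.

Definition uniform01 : set (measurableTypeR R) -> \bar R :=
  mrestr lebesgue_measure (measurable_itv (`[0, 1[ : interval R)).
HB.instance Definition _ := Measure.on uniform01.

Let uniform01_setT : uniform01 setT = 1%E.
Proof.
by rewrite /uniform01 /mrestr setTI lebesgue_measure_itv /= lte_fin ltr01 sube0.
Qed.
HB.instance Definition _ :=
  Measure_isProbability.Build _ _ _ uniform01 uniform01_setT.

End UniformUnit.

Section ProductLaw.
Variables (R : realType) (S : finType) (mu : probability (selfmap S) R).

Let mass (f : selfmap S) : R := fine (mu [set f]).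

Let mass_ge0 f : 0 <= mass f.
Proof. exact: fine_ge0. Qed.

Let mass_sum1 : \sum_f mass f = 1.
Proof.
apply: EFin_inj; rewrite -sumEFin -(probability_setT mu) selfmap_law_sum.
by apply: eq_bigl => f; rewrite in_setT.
Qed.

(** The coding is made constant off [0, 1[, which is null for the uniform law:
only there could the digits fail to correspond to cells. *)
Definition coding (x : measurableTypeR R) : mapseq S :=
  if 0 <= x < 1 then sample (point : selfmap S) mass x else fun=> point.

Lemma measurable_coding : measurable_fun setT coding.
Proof.
(* Coordinate events are events about the first s + 1 digits, except outside
   [0, 1[, where the coding is constant. *)
apply: (@measurability _ _ _ (mapseq S) setT coding (cylinders S)) => //.
move=> _ [_ [s [A ->]] <-].
rewrite setTI.
pose A' n := if n == s then A else setT.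
pose E := [set y : R | sample_event (point : selfmap S) mass s.+1 A' ((y - 0) / 1)].
have [mE _] := lebesgue_sample_event (point : selfmap S) mass_ge0 mass_sum1
  s.+1 A' 0 (@ltr01 R).
have -> : coding @^-1` [set F | A (F s)] =
    E `|` (if point \in A then ~` `[0, 1[%classic else set0).
  apply/seteqP; split => x; rewrite /E /coding /sample_event /= subr0 divr1.
    case: ifPn => x01 Ax; [left; split=> // n _|right].
      by rewrite /A'; case: eqP => // ->.
    by rewrite mem_set //= in_itv /=; exact/negP.
  case=> [[-> /(_ s (leqnn _))]|]; first by rewrite /A' eqxx.
  by case: ifPn => //; rewrite inE /= in_itv /= => Ap /negP/negPf ->.
apply: measurableU => //; case: ifPn => // _.
by apply: measurableC; exact: measurable_itv.
Qed.

HB.instance Definition _ :=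
  isMeasurableFun.Build _ _ _ _ coding measurable_coding.

Lemma product_law_ex : exists bmu : probability (mapseq S) R, product_law mu bmu.
Proof.
exists (distribution (@uniform01 R) coding) => t A.
rewrite /distribution /pushforward /uniform01 /mrestr /=.
have [_] := lebesgue_sample_event (point : selfmap S) mass_ge0 mass_sum1
  t A 0 (@ltr01 R).
rewrite mul1e (eq_bigr _ (fun (s : 'I_t) _ => selfmap_law_sum mu (A s))) => <-.
congr (lebesgue_measure _).
apply/seteqP; split => x; rewrite /sample_event /coding /= subr0 divr1 in_itv /=.
  by case=> + x01; rewrite x01.
by case=> x01; rewrite x01.
Qed.

End ProductLaw.

(** * Laws with prescribed masses *)

Section LawOfMasses.
Variables (R : realType) (S : finType) (w : selfmap S -> R).
Hypotheses (w_ge0 : forall f, 0 <= w f) (w_sum1 : \sum_f w f = 1).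

Let atom (k : nat) : selfmap S := nth point (index_enum (selfmap S)) k.

Definition law_of_masses : set (selfmap S) -> \bar R :=
  msum (fun k => mscale (NngNum (w_ge0 (atom k))) (dirac (atom k)))
       (size (index_enum (selfmap S))).
HB.instance Definition _ := Measure.on law_of_masses.

Lemma law_of_massesE A : law_of_masses A = (\sum_(f | f \in A) (w f)%:E)%E.
Proof.
rewrite /law_of_masses /msum /mscale /=.
rewrite -(big_mkord xpredT (fun k => (w (atom k))%:E * \d_(atom k) A)%E).
rewrite -(big_nth point xpredT (fun f => (w f)%:E * \d_f A)%E).
rewrite [RHS]big_mkcond /=; apply: eq_bigr => f _.
by rewrite diracE; case: ifP => fA; rewrite ?mule1 ?mule0.
Qed.

Let law_of_masses_setT : law_of_masses setT = 1%E.
Proof.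
rewrite law_of_massesE -w_sum1 -sumEFin.
by apply: eq_bigl => f; rewrite in_setT.
Qed.
HB.instance Definition _ :=
  Measure_isProbability.Build _ _ _ law_of_masses law_of_masses_setT.

Lemma law_of_masses_ex : exists mu : probability (selfmap S) R,
  forall A, mu A = (\sum_(f | f \in A) (w f)%:E)%E.
Proof. by exists law_of_masses; exact: law_of_massesE. Qed.

End LawOfMasses.

(** * Coalescence classes *)

Section Classes.
Variable S : finType.
Implicit Types F : nat -> selfmap S.

Lemma forward_merge F i j t t' : (t <= t')%N ->
  forward F t i = forward F t j -> forward F t' i = forward F t' j.
Proof.
move=> /subnK <-; elim: (t' - t)%N => //= k IH /IH.
by rewrite /comp => ->.
Qed.

Lemma coalesce_trans F : transitive (fun i j => `[< coalesce F i j >]).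
Proof.
move=> j i k /asboolP[s [s0 ij]] /asboolP[t [t0 jk]]; apply/asboolP.
exists (maxn s t); split; first by rewrite leq_max s0.
by rewrite (forward_merge (leq_maxl s t) ij) (forward_merge (leq_maxr s t) jk).
Qed.

Lemma coalesce_sym F : symmetric (fun i j => `[< coalesce F i j >]).
Proof.
by move=> i j; apply/asboolP/asboolP => -[t [t0 e]]; exists t.
Qed.

Lemma coalesce_refl F i : `[< coalesce F i i >].
Proof. by apply/asboolP; exists 1%N. Qed.

(** The classes are the values of the map sending a state to its class, so there
are |S| of them exactly when this map is injective. *)
Lemma coalescence_classes_card F :
  coalescence_classes F = #|S| <-> forall i j, coalesce F i j -> i = j.
Proof.
rewrite /coalescence_classes /equivalence_partition -cardsT.
split=> [/eqP/imset_injP inj i j ij|noc].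
  apply: inj; rewrite ?inE //; apply/setP => k; rewrite !inE.
  have cij : `[< coalesce F i j >] by apply/asboolP.
  by apply/idP/idP; apply: coalesce_trans => //; rewrite coalesce_sym.
rewrite card_in_imset // => i j _ _ /setP /(_ j); rewrite !inE coalesce_refl.
by move=> /asboolP/noc.
Qed.

Lemma forward_inj F t : (forall s, injective (F s)) -> injective (forward F t).
Proof. by move=> injF; elim: t => //= t IH; exact: inj_comp. Qed.

End Classes.

(** * Coalescence number and support *)

Section Support.
Variables (R : realType) (S : finType) (mu : probability (selfmap S) R).

Lemma product_law_marginal bmu s (A : set (selfmap S)) :
  product_law mu bmu -> bmu [set F | A (F s)] = mu A.
Proof.
move=> bmuP; have := bmuP s.+1 (fun n => if n == s then A else setT).
rewrite big_ord_recr /= eqxx big1 => [|i _]; last first.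
  by rewrite ltn_eqF ?probability_setT.
rewrite mul1e => <-; congr (bmu _); apply/seteqP; split=> F /= AF.
  by move=> n _; case: eqP => // ->.
by have := AF s (leqnn _); rewrite eqxx.
Qed.

Lemma measurable_coordinate s (A : set (selfmap S)) :
  measurable ([set F | A (F s)] : set (mapseq S)).
Proof. by apply: sub_sigma_algebra; exists s, A. Qed.

(** The event F_0 = f is enough to detect a non-injective f of positive mass:
two states merged at the first step stay merged, so a null set containing the
sequences with fewer than |S| classes would contain this event. *)
Lemma coalescence_number_card :
  coalescence_number mu #|S| <-> (forall f, support_law mu f -> bijective f).
Proof.
split=> [[bmu [bmuP [N [mN N0 subN]]]] f fpos|bij].
  apply/injF_bij => i j fij; apply: contrapT => ij.
  have : (bmu [set F | F 0%N = f] <= bmu N)%E.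
    apply: le_measure; rewrite ?inE //; first exact: (measurable_coordinate 0 [set f]).
    move=> F F0; apply: subN => /= /coalescence_classes_card /(_ i j).
    by move=> H; apply/ij/H; exists 1%N; split=> //=; rewrite F0.
  by rewrite (product_law_marginal 0 [set f] bmuP) N0 leNgt fpos.
have [bmu bmuP] := product_law_ex mu.
exists bmu; split=> //.
pose N s := [set F : mapseq S | ~ injective (F s)].
apply: (@negligibleS _ _ _ _ (\bigcup_s N s)).
  move=> F /= nF; apply: contrapT => NF; apply/nF/coalescence_classes_card.
  move=> i j [t [_]]; apply: forward_inj => s; apply: contrapT => ninj.
  by apply: NF; exists s.
apply: negligible_bigcup => s.
pose A := [set f : selfmap S | ~ injective f].
exists (N s); split=> //; first exact: (measurable_coordinate s A).
rewrite [LHS](product_law_marginal s A bmuP) selfmap_law_sum big1 // => f.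
rewrite inE => ninj; congr (_%:E); apply/eqP.
rewrite eq_le fine_ge0 // andbT leNgt; apply/negP => fpos.
apply/ninj/bij_inj/bij; rewrite /support_law /=.
by rewrite -[mu _]fineK ?lte_fin // fin_num_measure.
Qed.

End Support.

(** * Permutations and doubly stochastic matrices *)

Theorem theorem4 (R : realType) (S : finType) (n : nat)
    (hS : #|S| = n) (hn : (2 <= n)%N)
    (P : S -> S -> R) (hP : irreducible_stochastic P) :
  (forall mu : probability (selfmap S) R, consistent_laws P mu ->
     (coalescence_number mu n <->
      (forall f, support_law mu f -> bijective f))) /\
  (coalescence_numbers P n <-> doubly_stochastic P).
Proof.
have [stoP _] := hP; have [P0 rowP] := stoP.
split=> [mu _|]; first by rewrite -hS; exact: coalescence_number_card.
split=> [[mu [muP kmu]]|[_ colP]].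
  rewrite -hS in kmu; have /coalescence_number_card bij := kmu.
  split=> // j; apply: EFin_inj; rewrite -sumEFin.
  under eq_bigr do rewrite muP selfmap_law_sum big_mkcond.
  (* Exchanging the sums leaves the mass of f times the number of preimages
     of j under f, which is 1 as soon as the mass is positive. *)
  rewrite exchange_big -(probability_setT mu) selfmap_law_sum [RHS]big_mkcond /=.
  apply: eq_bigr => f _; rewrite in_setT.
  have [f0|f0] := eqVneq (fine (mu [set f])) 0.
    by rewrite f0; apply: big1 => i _; case: ifP.
  have fpos : support_law mu f.
    rewrite /support_law /= -[mu _]fineK ?fin_num_measure // lte_fin.
    by rewrite lt_neqAle eq_sym f0 fine_ge0.
  have [g gK Kg] := bij f fpos.
  rewrite (bigD1 (g j)) //= mem_set /= ?Kg // big1 ?adde0 // => i.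
  by case: ifPn => //; rewrite inE /= => <-; rewrite gK eqxx.
have [w [w0 wi wP]] :=
  birkhoff_von_neumann (And3 P0 rowP colP : line_sums P 1).
have [i0 _] : exists i0 : S, i0 \in S by apply/card_gt0P; rewrite hS ltnW.
(* The weights sum to 1 because those with f i0 = j sum to P i0 j. *)
have w1 : \sum_(f : selfmap S) w f = 1.
  rewrite -(rowP i0) (partition_big (fun f : selfmap S => f i0) xpredT) //=.
  by apply: eq_bigr => j _; exact: wP.
have [mu muA] := law_of_masses_ex w0 w1.
have muE f : mu [set f] = (w f)%:E.
  by rewrite muA (big_pred1 f) // => g; apply/idP/eqP; rewrite inE.
exists mu; split=> [i j|].
  rewrite muA sumEFin -wP; congr (_%:E).
  by apply: eq_bigl => f; apply/eqP/idP; rewrite inE.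
rewrite -hS; apply/coalescence_number_card => f.
rewrite /support_law /= muE lte_fin => /wi; exact: injF_bij.
Qed.
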